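(* For every integer $n\geq 2$, $$n!\leq \operatorname{GM}_3(P_5:nK_2)=\operatorname{M}_3(nK_2)\leq \frac{(2n)!}{2^{n}\,n!}.$$
   Context: All graphs are finite, simple and undirected; colorings are edge-colorings. $P_5$ is the path on $5$ vertices; $nK_2$ is a matching with $n$ edges. A $k$-coloring is exact if all $k$ colors are used at least once. A colored graph is rainbow if no two of its edges have the same color, and monochromatic if all its edges have the same color. Copies of a graph are counted as (not necessarily induced) subgraphs. The Gallai-Ramsey number $\operatorname{gr}_k(G:H)$ is the minimum integer $m$ with $\binom{m}{2}\geq k$ such that for every $N\geq m$, every exact $k$-coloring of $K_N$ contains a rainbow copy of $G$ or a monochromatic copy of $H$. The Gallai-Ramsey multiplicity $\operatorname{GM}_k(G:H)$ (also written $\operatorname{GM}_k(G,H)$) is the minimum, over all exact $k$-colorings of $K_{\operatorname{gr}_k(G:H)}$, of the total number of rainbow copies of $G$ and monochromatic copies of $H$. The Ramsey number $\operatorname{r}_k(H)$ is the least $r$ such that every $k$-coloring (not necessarily exact) of $K_r$ contains a monochromatic copy of $H$, and the Ramsey multiplicity $\operatorname{M}_k(H)$ is the minimum number of monochromatic copies of $H$ over all $k$-colorings of $K_{\operatorname{r}_k(H)}$. *)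

(* Defs.v *)
From mathcomp Require Import all_boot.

Set Implicit Arguments.
Unset Strict Implicit.
Unset Printing Implicit Defensive.

Definition edge (T : finType) := {e : {set T} | #|e| == 2}.

(* A finite simple undirected graph with vertex set T is its set of edges. *)
Definition graph (T : finType) := {set edge T}.

Definition path_graph (n : nat) : graph 'I_n :=
  [set e : edge 'I_n |
    [exists i : 'I_n, exists j : 'I_n, (j == i.+1 :> nat) && (val e == [set i; j])]].

(* n K_2 : the vertices are (i, false) and (i, true) for i < n. *)
Definition matching_graph (n : nat) : graph ('I_n * bool)%type :=
  [set e : edge ('I_n * bool)%type |
    [exists i : 'I_n, val e == [set (i, false); (i, true)]]].

Definition coloring (k N : nat) := {ffun edge 'I_N -> 'I_k}.

Definition exact (k N : nat) (c : coloring k N) : bool :=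
  [forall i : 'I_k, exists e : edge 'I_N, c e == i].

(* A subgraph of K_N is a pair (vertex set, edge set).  The vertex set is kept
   so that graphs with isolated vertices are also counted correctly. *)
Definition is_copy (T : finType) (G : graph T) (N : nat)
    (S : {set 'I_N} * graph 'I_N) : bool :=
  [exists f : {ffun T -> 'I_N},
    [&& injectiveb f,
        S.1 == f @: [set: T] &
        S.2 == [set e : edge 'I_N | [exists e0 in G, val e == f @: val e0]]]].

Definition rainbow (k N : nat) (c : coloring k N) (E : graph 'I_N) : bool :=
  [forall e1 in E, forall e2 in E, (c e1 == c e2) ==> (e1 == e2)].

Definition monochromatic (k N : nat) (c : coloring k N) (E : graph 'I_N) : bool :=
  [forall e1 in E, forall e2 in E, c e1 == c e2].

Definition rainbow_copies (T : finType) (G : graph T) (k N : nat)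
    (c : coloring k N) : {set {set 'I_N} * graph 'I_N} :=
  [set S | is_copy G S && rainbow c S.2].

Definition mono_copies (T : finType) (H : graph T) (k N : nat)
    (c : coloring k N) : {set {set 'I_N} * graph 'I_N} :=
  [set S | is_copy H S && monochromatic c S.2].

Definition is_minimum (P : nat -> Prop) (m : nat) : Prop :=
  P m /\ forall m', P m' -> m <= m'.

(* The four numbers below are minima that need not exist for arbitrary
   arguments, so each is given by its graph: "m is the value of ...". *)

Definition is_gallai_ramsey (k : nat) (T U : finType) (G : graph T) (H : graph U)
    : nat -> Prop :=
  is_minimum (fun m => k <= 'C(m, 2) /\
    forall N, m <= N -> forall c : coloring k N, exact c ->
      (exists S, S \in rainbow_copies G c) \/ (exists S, S \in mono_copies H c)).

Definition is_GM (k : nat) (T U : finType) (G : graph T) (H : graph U)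
    (v : nat) : Prop :=
  exists2 N, is_gallai_ramsey k G H N &
    is_minimum (fun t => exists2 c : coloring k N, exact c &
                  t = #|rainbow_copies G c| + #|mono_copies H c|) v.

Definition is_ramsey (k : nat) (U : finType) (H : graph U) : nat -> Prop :=
  is_minimum (fun r => forall c : coloring k r, exists S, S \in mono_copies H c).

Definition is_M (k : nat) (U : finType) (H : graph U) (v : nat) : Prop :=
  exists2 N, is_ramsey k H N &
    is_minimum (fun t => exists c : coloring k N, t = #|mono_copies H c|) v.

(* Main.v *)
Require Import Defs.
From mathcomp Require Import all_boot zify.

(* A rainbow P_5 needs four colours, so only monochromatic matchings count, and
   both Ramsey-type numbers equal 4n-2. The extremal colourings give an edge the
   colour of the class of its larger end, for classes of sizes 2n-1, n-1, n-1
   (on 4n-3 vertices) or 2n, n-1, n-1 (on 4n-2 vertices).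

   The lower bound n! is proved by induction on n, for every 3-colouring of a
   complete graph on 4n-2 vertices.
   - If a vertex v has degree at least n in every colour, pick n disjoint rainbow
     stars K_{1,3} centred at v. Removing one of them leaves (n-1)! monochromatic
     (n-1)K_2, each extended by the star edge of its colour; matchings from
     different stars differ at v, which gives n * (n-1)!. The same works if v has
     only one colour g of degree less than n while some u has at least 2n-1
     neighbours in colour g.
   - If n vertices have degree at least 2n-1 in one colour, match them greedily
     to vertices outside of them.
   - Otherwise, counting vertices by their sets of small degrees yields a colour
     in which at least (8n-4)/3 vertices have degree at least n. Comparing the
     numbers of k-matchings and (k+1)-matchings of that colour through augmenting
     paths of length 1 and 3 then gives n! matchings of size n.

   The minimum over all colourings is attained by an exact one: recolouring an
   edge with an unused colour creates no monochromatic nK_2, as n >= 2. *)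

Set Implicit Arguments.
Unset Strict Implicit.
Unset Printing Implicit Defensive.

(** * Matchings in a set of edges *)

Lemma leq_card_inj (S T : finType) (A : {set S}) (B : {set T}) (f : S -> T) :
  {in A &, injective f} -> {in A, forall x, f x \in B} -> #|A| <= #|B|.
Proof.
move=> fI fB; rewrite -(card_in_imset fI) subset_leq_card //.
by apply/subsetP=> _ /imsetP[x xA ->]; exact: fB.
Qed.

(** A finite dependent sum: iterated sums of cardinalities become one cardinality, so that counting
    inequalities can be proved by injections. *)
Definition dep_pairs (S T : finType) (A : {set S}) (F : S -> {set T}) :=
  [set p : S * T | (p.1 \in A) && (p.2 \in F p.1)].

Lemma in_dep_pairs (S T : finType) (A : {set S}) (F : S -> {set T}) x y :
  ((x, y) \in dep_pairs A F) = (x \in A) && (y \in F x).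
Proof. by rewrite [LHS]inE. Qed.

Lemma card_dep_pairs (S T : finType) (A : {set S}) (F : S -> {set T}) :
  #|dep_pairs A F| = \sum_(x in A) #|F x|.
Proof.
rewrite -sum1_card; under eq_bigl do rewrite inE.
rewrite -(pair_big_dep (mem A) (fun x y => y \in F x) (fun _ _ => 1)) /=.
by apply: eq_bigr => x _; rewrite sum1_card.
Qed.

(** Points of [B] stay fixed; the part of [A] outside [B] is sent, by position, into the part of [B]
    outside [A], which is at least as large. *)
Lemma inj_extending_id (T : finType) (A B : {set T}) :
  #|A| <= #|B| ->
  exists f : T -> T, [/\ {in A &, injective f}, {in A, forall x, f x \in B} &
                        {in B, forall x, f x = x}].
Proof.
move=> leAB.
have leD : #|A :\: B| <= #|B :\: A|.
  by move: leAB (cardsID B A) (cardsID A B); rewrite (setIC B A); lia.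
pose g x := nth x (enum (B :\: A)) (index x (enum (A :\: B))).
have gB x : x \in A :\: B -> g x \in B :\: A.
  move=> xAB; rewrite -mem_enum mem_nth // -cardE.
  by apply: leq_trans leD; rewrite cardE index_mem mem_enum.
exists (fun x => if x \in B then x else g x); split.
- move=> x y xA yA; case: ifP => xB; case: ifP => yB //.
  + by move=> e; have := gB y; rewrite !inE yA yB -e xA /= => /(_ isT).
  + by move=> e; have := gB x; rewrite !inE xA xB e yA /= => /(_ isT).
  + have xAB : x \in A :\: B by rewrite inE xA xB.
    have yAB : y \in A :\: B by rewrite inE yA yB.
    rewrite /g (set_nth_default x y); last first.
      by rewrite -cardE (leq_trans _ leD) // cardE index_mem mem_enum.
    move/eqP; rewrite nth_uniq ?enum_uniq //.
    * by move/eqP/index_inj=> -> //; rewrite mem_enum.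
    * by rewrite -cardE (leq_trans _ leD) // cardE index_mem mem_enum.
    * by rewrite -cardE (leq_trans _ leD) // cardE index_mem mem_enum.
- by move=> x xA /=; case: ifP => // xB; have := gB x; rewrite !inE xA xB => /(_ isT)/andP[].
- by move=> x /= ->.
Qed.

Lemma subset_of_card (T : finType) (A : {set T}) k :
  k <= #|A| -> exists2 B : {set T}, B \subset A & #|B| = k.
Proof.
move=> leA; exists [set x in take k (enum A)].
  by apply/subsetP=> x; rewrite inE => /mem_take; rewrite mem_enum.
rewrite cardsE; have /card_uniqP-> : uniq (take k (enum A)) by rewrite take_uniq ?enum_uniq.
by rewrite size_take -cardE; case: ltnP => //; lia.
Qed.

Definition matchings (V : finType) (E : {set {set V}}) (k : nat) :=
  [set P : {set {set V}} | [&& P \subset E, trivIset P & #|P| == k]].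

Lemma matchingsP (V : finType) (E P : {set {set V}}) k :
  reflect [/\ P \subset E, trivIset P & #|P| = k] (P \in matchings E k).
Proof. by rewrite inE; apply: (iffP and3P) => -[? ? /eqP]. Qed.

Lemma matchingsS (V : finType) (E E' : {set {set V}}) k :
  E \subset E' -> matchings E k \subset matchings E' k.
Proof.
move=> sE; apply/subsetP=> P /matchingsP[sP tP cP]; apply/matchingsP; split=> //.
exact: subset_trans sP sE.
Qed.

Lemma matchings0 (V : finType) (E : {set {set V}}) : #|matchings E 0| = 1.
Proof.
rewrite (_ : matchings E 0 = [set set0]) ?cards1 //.
apply/setP=> P; rewrite !inE cards_eq0; case: eqP => [->|]; last by rewrite !andbF.
by rewrite sub0set /=; apply/andP; split => //; apply/trivIsetP => B C; rewrite inE.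
Qed.

Lemma trivIset_setU1 (V : finType) (e : {set V}) (P : {set {set V}}) :
  trivIset P -> {in P, forall f : {set V}, [disjoint e & f]} -> trivIset (e |: P).
Proof.
move=> tP dP; apply/trivIsetP=> A B; rewrite !inE.
move=> /orP[/eqP->|AP] /orP[/eqP->|BP] neq.
- by rewrite eqxx in neq.
- exact: dP.
- by rewrite disjoint_sym dP.
- exact: (trivIsetP tP).
Qed.

Definition avoiding (V : finType) (E : {set {set V}}) (Q : {set V}) :=
  [set f in E | [disjoint f & Q]].

(* Every edge [e x] meets the core [K], while the rest of the matching built
   from index [x] avoids [K]: so [e x], and hence [x], can be recovered. *)
Lemma matchings_through_core (V J : finType) (E : {set {set V}}) (K : {set V})
    (I : {set J}) (e Q : J -> {set V}) k :
    {in I &, injective e} ->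
    {in I, forall x, [/\ e x \in E, ~~ [disjoint e x & K], K \subset Q x &
                         e x \subset Q x]} ->
  \sum_(x in I) #|matchings (avoiding E (Q x)) k| <= #|matchings E k.+1|.
Proof.
move=> eI eP; rewrite -card_dep_pairs.
have avK x P f : x \in I -> P \in matchings (avoiding E (Q x)) k -> f \in P ->
    [disjoint f & Q x].
  move=> xI /matchingsP[/subsetP sP _ _] /sP; rewrite inE => /andP[_ ] //.
have avN x P f : x \in I -> P \in matchings (avoiding E (Q x)) k -> f \in P ->
    [disjoint f & K].
  move=> xI PM fP; have [_ _ sK _] := eP x xI.
  exact: disjointWr sK (avK _ _ _ xI PM fP).
have core x P y : x \in I -> y \in I -> P \in matchings (avoiding E (Q x)) k ->
    e y \in e x |: P -> y = x.
  move=> xI yI PM; rewrite !inE => /orP[/eqP/eI->//|/(avN _ _ _ xI PM)].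
  by have [_ /negbTE->] := eP y yI.
have eNP x P : x \in I -> P \in matchings (avoiding E (Q x)) k -> e x \notin P.
  move=> xI PM; apply/negP=> /(avN _ _ _ xI PM).
  by have [_ /negbTE->] := eP x xI.
apply: (@leq_card_inj _ _ _ _ (fun p => e p.1 |: p.2)).
- move=> [x P] [y R] /=; rewrite !in_dep_pairs => /andP[xI PM] /andP[yI RM] eq.
  have eyx : y = x by apply: (core x P) => //; rewrite eq setU11.
  rewrite -{}eyx in xI PM eq *.
  by congr (_, _); rewrite -(setU1K (eNP y P xI PM)) eq setU1K // eNP.
- move=> [x P] /=; rewrite in_dep_pairs => /andP[xI PM].
  have [eE _ _ eQ] := eP x xI.
  have /matchingsP[sP tP cP] := PM; apply/matchingsP; split.
  + rewrite subUset sub1set eE; apply: subset_trans sP _.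
    by apply/subsetP=> f; rewrite inE => /andP[].
  + apply: trivIset_setU1 => // f fP.
    by rewrite disjoint_sym; exact: disjointWr eQ (avK _ _ _ xI PM fP).
  + by rewrite cardsU1 eNP // cP.
Qed.

Definition nbrs (V : finType) (E : {set {set V}}) (v : V) :=
  [set x | (x != v) && ([set v; x] \in E)].

Lemma nbrsC (V : finType) (E : {set {set V}}) u v : (u \in nbrs E v) = (v \in nbrs E u).
Proof. by rewrite !inE eq_sym setUC. Qed.

Lemma set2_inj (V : finType) (v : V) : injective (fun x => [set v; x]).
Proof.
move=> x y e.
have : x \in [set v; y] by rewrite -e set22.
rewrite !inE => /orP[/eqP xv|/eqP//].
have : y \in [set v; x] by rewrite e set22.
by rewrite !inE xv orbb => /eqP.
Qed.

(** Greedy choice: match some [v] in [S] with any of its neighbours outside [S] and delete both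
    ends. Every other vertex of [S] loses at most one outside neighbour, while [S] itself loses one
    vertex. *)
Lemma star_matchings (V : finType) (E : {set {set V}}) (S : {set V}) :
    {in S, forall v, #|S| <= #|nbrs E v :\: S|} ->
  #|S|`! <= #|matchings E #|S| |.
Proof.
move: {2}#|S| (erefl #|S|) => k; elim: k E S => [|k IH] E S cS hS.
  by rewrite cS matchings0.
have [v vS] : exists v, v \in S by apply/set0Pn; rewrite -card_gt0 cS.
have cS' : #|S :\ v| = k by move: (cardsD1 v S); rewrite vS cS; lia.
rewrite cS factS.
apply: (@leq_trans (\sum_(x in nbrs E v :\: S) k`!)).
  by rewrite sum_nat_const leq_mul2r -cS hS // orbT.
apply: leq_trans (@matchings_through_core _ _ E [set v] (nbrs E v :\: S)
  (fun x => [set v; x]) (fun x => [set v; x]) k _ _).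
- apply: leq_sum => x; rewrite !inE => /and3P[xS xv vxE].
  rewrite -cS'; apply: IH => // w; rewrite !inE => /andP[wv wS].
  rewrite cS' -ltnS -cS; apply: leq_trans (hS w wS) _.
  have -> : #|nbrs E w :\: S| <= #|(nbrs (avoiding E [set v; x]) w :\: (S :\ v))|.+1 = true => //.
  apply: (@leq_trans #|x |: (nbrs (avoiding E [set v; x]) w :\: (S :\ v))|); last first.
    by rewrite cardsU1; case: (_ \in _).
  apply/subset_leq_card/subsetP=> y; rewrite !inE => /and3P[yS yw wyE].
  case: eqP => //= /eqP yx; rewrite yw wyE (negbTE yS) andbF /=.
  rewrite disjoint_subset; apply/subsetP=> z; rewrite !inE.
  move=> /orP[]/eqP->; first by rewrite (negbTE wv); apply: contraNneq xS => <-.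
  by rewrite (negbTE yx) orbF; apply: contraNneq yS => ->.
- by move=> x y _ _; exact: set2_inj.
- move=> x; rewrite !inE => /and3P[xS xv vxE]; split=> //.
  + by apply/pred0Pn; exists v; rewrite !inE eqxx.
  + by rewrite sub1set !inE eqxx.
Qed.

(** * Augmenting paths *)

Lemma card_cover_matching (V : finType) (E P : {set {set V}}) k :
  {in E, forall e : {set V}, #|e| = 2} -> P \in matchings E k -> #|cover P| = 2 * k.
Proof.
move=> E2 /matchingsP[/subsetP sP tP cP].
have [_] := leq_card_cover P; rewrite tP => /eqP->.
by rewrite (eq_bigr (fun=> 2)) => [|e /sP/E2//]; rewrite sum_nat_const cP mulnC.
Qed.

(** Oriented edges: an augmenting path of length 3 crosses its middle edge in a definite direction,
    so the two orientations are counted apart. *)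
Definition darts (V : finType) (P : {set {set V}}) :=
  [set p : V * V | [set p.1; p.2] \in P].

Lemma trivIset_eq (V : finType) (P : {set {set V}}) (e f : {set V}) x :
  trivIset P -> e \in P -> f \in P -> x \in e -> x \in f -> e = f.
Proof.
move=> tP eP fP xe xf; apply/eqP; case: eqVneq => // ef.
by have /pred0P/(_ x) := trivIsetP tP e f eP fP ef; rewrite /= xe xf.
Qed.

Lemma notin_cover (V : finType) (P : {set {set V}}) (e : {set V}) x :
  x \notin cover P -> x \in e -> e \notin P.
Proof.
by move=> xP xe; apply: contra xP => eP; apply/bigcupP; exists e.
Qed.

Lemma mem_cover2 (V : finType) (P : {set {set V}}) x y :
  [set x; y] \in P -> (x \in cover P) /\ (y \in cover P).
Proof. by split; apply/bigcupP; exists [set x; y]; rewrite // !inE eqxx ?orbT. Qed.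

Lemma card_darts (V : finType) (E P : {set {set V}}) k :
  {in E, forall e : {set V}, #|e| = 2} -> P \in matchings E k -> #|darts P| <= 2 * k.
Proof.
move=> E2 PM; rewrite -(card_cover_matching E2 PM).
have /matchingsP[sP tP cP] := PM.
apply: (@leq_card_inj _ _ _ _ (fun p => p.1)) => [[x y] [z w]|[x y]]; rewrite !inE /=.
  move=> xyP zwP xz; rewrite -{}xz in zwP *; congr (_, _).
  apply: (@set2_inj _ x); apply: (trivIset_eq tP xyP zwP (x := x));
  by rewrite !inE eqxx.
by case/mem_cover2.
Qed.

Lemma cover_mate (V : finType) (E P : {set {set V}}) k x :
    {in E, forall e : {set V}, #|e| = 2} -> P \in matchings E k -> x \in cover P ->
  exists y, (x, y) \in darts P.
Proof.
move=> E2 /matchingsP[/subsetP sP _ _] /bigcupP[e eP xe].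
have /eqP/cards2P[y [z [yz ee]]] := E2 e (sP e eP).
move: xe eP; rewrite {}ee !inE => /orP[]/eqP-> eP; first by exists z; rewrite inE.
by exists y; rewrite inE /= setUC.
Qed.

Section Augment.

Variables (V : finType) (E : {set {set V}}) (W : {set V}) (n : nat).
Hypothesis E2 : {in E, forall e : {set V}, #|e| = 2}.
Hypothesis degW : {in W, forall v, n <= #|nbrs E v|}.

Let free (M : {set {set V}}) := W :\: cover M.
(** For free [u] and [w], [direct] lists the far ends of the augmenting paths of length 1 from [u],
    and [detour] the oriented middle edges of the paths [u], [x], [y], [w]. *)
Let direct M u := nbrs E u :\: cover M.
Let detour M u w :=
  [set p in darts M | (p.1 \in nbrs E u) && (p.2 \in nbrs E w)].

(** Inclusion-exclusion among at most [2 * k] darts: [X] and [Y] are at least as large as the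
    degrees of [u] and [w] less their [direct] terms, and they meet in the detours. *)
Let pair_bound k M u w : M \in matchings E k -> u \in W -> w \in W ->
  2 * (n - k) <= #|detour M u w| + (#|direct M u| + #|direct M w|).
Proof.
move=> MM uW wW.
pose X := [set p in darts M | p.1 \in nbrs E u].
pose Y := [set p in darts M | p.2 \in nbrs E w].
have cX : #|nbrs E u :&: cover M| <= #|X|.
  apply: leq_trans (leq_imset_card (fun p : V * V => p.1) X).
  apply/subset_leq_card/subsetP=> x; rewrite inE => /andP[xu xM].
  have [y xy] := cover_mate E2 MM xM.
  by apply/imsetP; exists (x, y); rewrite // inE xy.
have cY : #|nbrs E w :&: cover M| <= #|Y|.
  apply: leq_trans (leq_imset_card (fun p : V * V => p.2) Y).
  apply/subset_leq_card/subsetP=> x; rewrite inE => /andP[xu xM].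
  have [y xy] := cover_mate E2 MM xM.
  apply/imsetP; exists (y, x); rewrite // inE xu andbT.
  by move: xy; rewrite !inE /= setUC.
have cXY : #|X :|: Y| <= 2 * k.
  apply: leq_trans (card_darts E2 MM); apply/subset_leq_card.
  by apply/subsetP=> p; rewrite !inE => /orP[]/andP[].
have XY : X :&: Y = detour M u w.
  by apply/setP=> p; rewrite !inE; case: (_ \in M).
move: (degW uW) (degW wW) (cardsID (cover M) (nbrs E u)) (cardsID (cover M) (nbrs E w)).
move: (cardsUI X Y); rewrite XY /direct; lia.
Qed.

(** The pair bound is summed over ordered pairs of distinct free vertices; with [t] free vertices,
    each [direct] term occurs [2 * t.-1] times. *)
Let sum_bound k M (T := #|W| - 2 * k) : M \in matchings E k ->
  2 * (n - k) * (T * T.-1) <=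
    \sum_(u in free M) \sum_(w in free M :\ u) #|detour M u w|
    + 2 * T.-1 * \sum_(u in free M) #|direct M u|.
Proof.
move=> MM.
set X := \sum_(u in _) _; set Y := \sum_(u in _) _; set t := #|free M|.
have leTt : T <= t.
  rewrite /T /t -(card_cover_matching E2 MM) -(cardsID (cover M) W).
  by move: (subset_leq_card (subsetIr W (cover M))); rewrite /free; lia.
have H : 2 * (n - k) * (t * t.-1) <= X + 2 * t.-1 * Y.
  have cF u : u \in free M -> #|free M :\ u| = t.-1.
    by move=> uF; rewrite /t (cardsD1 u (free M)) uF.
  have -> : 2 * (n - k) * (t * t.-1) =
      \sum_(u in free M) \sum_(w in free M :\ u) 2 * (n - k).
    under eq_bigr => u uF do rewrite sum_nat_const cF //.
    by rewrite sum_nat_const -/t [RHS]mulnA [RHS]mulnC.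
  have -> : X + 2 * t.-1 * Y = \sum_(u in free M) \sum_(w in free M :\ u)
      (#|detour M u w| + (#|direct M u| + #|direct M w|)).
    under [RHS]eq_bigr => u uF.
      rewrite big_split /= big_split /= sum_nat_const cF //.
      have -> : \sum_(w in free M :\ u) #|direct M w| = Y - #|direct M u|.
        by rewrite /Y [in RHS](big_setD1 u uF) /= addKn.
      over.
    rewrite big_split /= -/X; congr (_ + _).
    rewrite big_split /= -big_distrr /= -/Y.
    have -> : \sum_(u in free M) (Y - #|direct M u|) = t.-1 * Y; last by lia.
    have : \sum_(u in free M) (Y - #|direct M u|) + Y = t * Y.
      rewrite {2}/Y -big_split /= -sum_nat_const; apply: eq_bigr => u uF.
      by rewrite subnK // /Y (bigD1 u) //= leq_addr.
    case: (t =P 0) => [t0|]; last by nia.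
    have -> : Y = 0 by rewrite /Y (cards0_eq t0) big_set0.
    by rewrite !muln0 addn0.
  apply: leq_sum => u; rewrite !inE => /andP[_ uW]; apply: leq_sum => w.
  by rewrite !inE => /and3P[_ _ wW]; exact: pair_bound.
case: (leqP t 1) => t1; first by (have -> : T * T.-1 = 0 by nia); rewrite muln0.
have tp : 0 < t.-1 by lia.
(* To replace [t] by its lower bound [T], scale by [T.-1 / t.-1]: the coefficient of [Y] becomes
   [2 * T.-1] and that of [X] at most 1. *)
rewrite -(leq_pmul2l tp).
have le1 : T.-1 <= t.-1 by lia.
apply: (@leq_trans (T.-1 * (X + 2 * t.-1 * Y))); last by nia.
apply: (@leq_trans (T.-1 * (2 * (n - k) * (t * t.-1)))); last by rewrite leq_mul2l H orbT.
rewrite (_ : t.-1 * _ = T.-1 * (2 * (n - k) * (T * t.-1))); last by lia.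
by rewrite !leq_mul.
Qed.

(** Adding the edge [u z] gives a larger matching with a marked dart; deleting the marked edge
    recovers [M]. *)
Let count_direct k :
  \sum_(M in matchings E k) \sum_(u in free M) #|direct M u|
    <= #|matchings E k.+1| * (2 * k.+1).
Proof.
under eq_bigr do rewrite -card_dep_pairs.
rewrite -card_dep_pairs.
have cT : #|dep_pairs (matchings E k.+1) (@darts V)| <= #|matchings E k.+1| * (2 * k.+1).
  rewrite card_dep_pairs -sum_nat_const; apply: leq_sum => M; exact: card_darts.
apply: leq_trans cT.
apply: (@leq_card_inj _ _ _ _ (fun q => ([set q.2.1; q.2.2] |: q.1, q.2))).
  move=> [M [u z]] [M' [u' z']]; rewrite !in_dep_pairs /=.
  move=> /and3P[_ uM _] /and3P[_ uM' _] [] + uu zz; rewrite -{}uu -{}zz in uM' *.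
  have nM N : u \in free N -> [set u; z] \notin N.
    by rewrite inE => /andP[uN _]; apply: notin_cover uN _; rewrite !inE eqxx.
  by move=> eq; congr (_, _); rewrite -(setU1K (nM M uM)) eq setU1K ?nM.
move=> [M [u z]]; rewrite !in_dep_pairs => /and3P[MM uM zM] /=.
rewrite [X in _ && X]inE /= setU11 andbT.
move: uM zM; rewrite !inE => /andP[uC uW] /and3P[zC zu uz].
have /matchingsP[sM tM cM] := MM; apply/and3P; split.
- by rewrite subUset sub1set uz.
- apply: trivIset_setU1 => // f fM; apply/pred0P=> x /=; apply/negP=> /andP[xuz xf].
  have xC : x \in cover M by apply/bigcupP; exists f.
  by move: xuz; rewrite !inE => /orP[]/eqP xE; rewrite -xE xC in uC zC.
- by rewrite cardsU1 (notin_cover uC) ?cM // !inE eqxx.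
Qed.

Let count_detour k :
  \sum_(M in matchings E k) \sum_(u in free M) \sum_(w in free M :\ u) #|detour M u w|
    <= #|matchings E k.+1| * (2 * k.+1 * (2 * k)).
Proof.
under eq_bigr => M _ do under eq_bigr do rewrite -card_dep_pairs.
under eq_bigr do rewrite -card_dep_pairs.
rewrite -card_dep_pairs.
(* The trade marks two darts on different edges, so the second one has only [2 * k] possible
   values. *)
pose other (M : {set {set V}}) (d : V * V) := darts (M :\ [set d.1; d.2]).
have cT : #|dep_pairs (matchings E k.+1) (fun M => dep_pairs (darts M) (other M))|
    <= #|matchings E k.+1| * (2 * k.+1 * (2 * k)).
  rewrite card_dep_pairs -sum_nat_const; apply: leq_sum => M MM.
  rewrite card_dep_pairs; apply: (@leq_trans (\sum_(d in darts M) 2 * k)).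
    apply: leq_sum => d; rewrite inE => dM; apply: (@card_darts _ E) => //.
    have /matchingsP[sM tM cM] := MM; apply/matchingsP; split.
    - by apply: subset_trans sM; exact: subD1set.
    - exact: trivIsetD.
    - by move: (cardsD1 [set d.1; d.2] M); rewrite dM cM add1n => -[].
  by rewrite sum_nat_const leq_mul2r (card_darts E2 MM) ?orbT.
apply: leq_trans cT.
pose base (q : {set {set V}} * (V * (V * (V * V)))) :=
  q.1 :\ [set q.2.2.2.1; q.2.2.2.2].
pose e1 (q : {set {set V}} * (V * (V * (V * V)))) := [set q.2.1; q.2.2.2.1].
pose e2 (q : {set {set V}} * (V * (V * (V * V)))) := [set q.2.2.1; q.2.2.2.2].
(* Freshness is stated in the order of insertion, [e2] before [e1]: it makes the result a matching,
   and removal in reverse order recovers [M]. *)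
have facts M u w x y (q := (M, (u, (w, (x, y))))) : M \in matchings E k ->
    u \in free M -> w \in free M :\ u -> (x, y) \in detour M u w ->
  [/\ e1 q \in E, e2 q \in E, [set x; y] \in M,
      {in base q, forall f : {set V}, [disjoint e2 q & f]} &
      {in e2 q |: base q, forall f : {set V}, [disjoint e1 q & f]}].
  rewrite !inE /= => /and3P[sM tM cM] /andP[uC uW] /and3P[wu wC wW] /andP[xyM /andP[/andP[xu uxE] /andP[yw wyE]]].
  have [xC yC] := mem_cover2 xyM.
  have dis f z : f \in base q -> z \in f -> [/\ z != u, z != w, z != x & z != y].
    rewrite !inE /= => /andP[fxy fM] zf.
    have zC : z \in cover M by apply/bigcupP; exists f.
    split; first by apply: contraNneq uC => <-.
    - by apply: contraNneq wC => <-.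
    - apply: contraNneq fxy => zx; apply/eqP; apply: (trivIset_eq tM fM xyM zf).
      by rewrite zx !inE eqxx.
    - apply: contraNneq fxy => zy; apply/eqP; apply: (trivIset_eq tM fM xyM zf).
      by rewrite zy !inE eqxx orbT.
  have xNy : x != y.
    apply/eqP=> xy; have := E2 (subsetP sM _ xyM); by rewrite xy setUid cards1.
  split=> //.
    move=> f fb; apply/pred0P=> z /=; apply/negP=> /andP[ze zf].
    have [zu zw zx zy] := dis f z fb zf.
    by move: ze; rewrite !inE /= (negbTE zw) (negbTE zy).
  move=> f; rewrite inE => /orP[|fb].
    rewrite inE => /eqP->; apply/pred0P=> z /=; apply/negP.
    rewrite !inE /= => /andP[/orP[]/eqP->].
      by rewrite eq_sym (negbTE wu) /= => /eqP uy; rewrite uy yC in uC.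
    by rewrite (negbTE xNy) orbF => /eqP xw; rewrite -xw xC in wC.
  apply/pred0P=> z /=; apply/negP=> /andP[ze zf].
  have [zu zw zx zy] := dis f z fb zf.
  by move: ze; rewrite !inE /= (negbTE zu) (negbTE zx).
have notin (f : {set V}) (P : {set {set V}}) x : x \in f ->
    {in P, forall g : {set V}, [disjoint f & g]} -> f \notin P.
  move=> xf dP; apply/negP=> fP; have /pred0P/(_ x) := dP f fP.
  by rewrite /= xf.
apply: (@leq_card_inj _ _ _ _
  (fun q => (e1 q |: (e2 q |: base q), ((q.2.1, q.2.2.2.1), (q.2.2.1, q.2.2.2.2))))).
  move=> [M [u [w [x y]]]] [M' [u' [w' [x' y']]]]; rewrite !in_dep_pairs /=.
  move=> /and4P[MM uM wM xM] /and4P[MM' uM' wM' xM'] [].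
  move=> + eu ex ew ey; rewrite -{}eu -{}ex -{}ew -{}ey in uM' wM' xM' *.
  have [_ _ xyM d2 d1] := facts M u w x y MM uM wM xM.
  have [_ _ xyM' d2' d1'] := facts M' u w x y MM' uM' wM' xM'.
  move=> eq; congr (_, _); rewrite -(setD1K xyM) -(setD1K xyM'); congr (_ |: _).
  have n1 := notin _ _ u (set21 _ _) d1; have n1' := notin _ _ u (set21 _ _) d1'.
  have n2 := notin _ _ w (set21 _ _) d2; have n2' := notin _ _ w (set21 _ _) d2'.
  rewrite [LHS](esym (setU1K n2)) [X in X :\ _](esym (setU1K n1)) eq.
  by rewrite [X in X :\ _](setU1K n1') (setU1K n2').
move=> [M [u [w [x y]]]]; rewrite !in_dep_pairs /= => /and4P[MM uM wM xM].
have [e1E e2E xyM d2 d1] := facts M u w x y MM uM wM xM.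
have n1 := notin _ _ u (set21 _ _) d1.
have n2 := notin _ _ w (set21 _ _) d2.
have /matchingsP[sM tM cM] := MM.
apply/and3P; split.
- apply/matchingsP; split.
  + rewrite !subUset !sub1set e1E e2E; exact: subset_trans (subD1set _ _) sM.
  + by do 2 apply: trivIset_setU1 => //; exact: trivIsetD.
  + by rewrite cardsU1 n1 cardsU1 n2 -cM (cardsD1 [set x; y] M) xyM.
- by rewrite inE /= setU11.
- rewrite inE /= in_setD1 in_setU1 setU11 orbT andbT.
  by apply: contraNneq n1 => <-; rewrite setU11.
Qed.

(* For uncovered [u], [w] in [W], a [k]-matching is enlarged by an edge [u z] with
   [z] uncovered, or by trading an edge [x y] for [u x] and [w y]; the degree
   bound gives at least [2 (n - k)] such moves for each pair, and a
   [(k+1)]-matching together with [u], [z] or [u], [x], [w], [y] determines the move. *)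
Lemma matchings_augment k (T := #|W| - 2 * k) :
  (n - k) * (T * T.-1) * #|matchings E k| <=
    2 * k.+1 * (k + T.-1) * #|matchings E k.+1|.
Proof.
rewrite -(leq_pmul2l (isT : 0 < 2)).
have : \sum_(M in matchings E k) 2 * (n - k) * (T * T.-1) <=
    \sum_(M in matchings E k)
      (\sum_(u in free M) \sum_(w in free M :\ u) #|detour M u w|
       + 2 * T.-1 * \sum_(u in free M) #|direct M u|).
  by apply: leq_sum => M; exact: sum_bound.
rewrite sum_nat_const big_split /= -big_distrr /=.
have := leq_mul (leqnn (2 * T.-1)) (count_direct k); have := count_detour k.
move: (\sum_(M in _) _) (\sum_(M in _) _) => a b; clearbody T.
move: (n - k) #|matchings E k| #|matchings E k.+1| T.-1 => j x y t; nia.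
Qed.

End Augment.

(** * Matchings in a graph with many vertices of large degree *)

Lemma matching2 (V : finType) (E : {set {set V}}) (e f : {set V}) x :
  e \in E -> f \in E -> x \in e -> [disjoint e & f] -> [set e; f] \in matchings E 2.
Proof.
move=> eE fE xe dis; apply/matchingsP; split.
- by apply/subsetP=> g; rewrite !inE => /orP[]/eqP->.
- apply: trivIset_setU1; first exact: trivIset1.
  by move=> g; rewrite inE => /eqP->.
- rewrite cards2; case: eqVneq => // ef.
  by have /pred0P/(_ x) := dis; rewrite -ef /= xe.
Qed.

Lemma disjoint_set2 (V : finType) (a b c d : V) :
  [disjoint [set a; b] & [set c; d]] = [&& a != c, a != d, b != c & b != d].
Proof. by rewrite disjoints_subset subUset !sub1set !inE !negb_or -andbA. Qed.

(** Take two edges at a vertex [a]. If each has a disjoint partner, this gives two matchings.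
    Otherwise some edge [a z] meets all edges, so every other vertex of [W] has neighbours exactly
    [a] and [z], and two such vertices can be matched to them in two ways. For [#|W| = 4] the
    augmentation bounds yield only one matching. *)
Lemma two_matchings (V : finType) (E : {set {set V}}) (W : {set V}) :
    4 <= #|W| -> {in W, forall v, 2 <= #|nbrs E v|} ->
  2 <= #|matchings E 2|.
Proof.
move=> W4 degW.
have [a aW] : exists a, a \in W by apply/set0Pn; rewrite -card_gt0; lia.
have nb u z : z \in nbrs E u -> z != u /\ [set u; z] \in E by rewrite inE => /andP[].
have /card_gt1P[x [y [xa ya xy]]] := degW a aW.
have [[xNa axE] [yNa ayE]] := (nb _ _ xa, nb _ _ ya).
have far z : z \in nbrs E a ->
    ~~ [exists e in E, [disjoint [set a; z] & e]] -> 2 <= #|matchings E 2|.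
  move=> za nz; have [zNa azE] := nb _ _ za.
  have /card_gt1P[p [q [pD qD pq]]] : 1 < #|W :\: [set a; z]|.
    by have := cardsID [set a; z] W; have := subset_leq_card (subsetIr W [set a; z]);
      rewrite cards2; case: (a != z); lia.
  have adj r : r \in W :\: [set a; z] -> [/\ r != a, r != z, [set a; r] \in E & [set z; r] \in E].
    rewrite !inE negb_or => /andP[/andP[ra rz] rW].
    have sN : nbrs E r \subset [set a; z].
      apply/subsetP=> t /nb[tr rtE]; apply: contraR nz => tN.
      apply/exists_inP; exists [set r; t] => //.
      rewrite disjoint_sym disjoint_subset; apply/subsetP=> s.
      rewrite [s \in [set r; t]]inE !in_set1 => /orP[]/eqP-> //.
      by rewrite !inE negb_or ra rz.
    have /eqP e : nbrs E r == [set a; z].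
      rewrite eqEcard sN; apply: leq_trans (degW r rW); rewrite cards2.
      by case: (a != z).
    have /nb[_ arE] : a \in nbrs E r by rewrite e !inE eqxx.
    have /nb[_ zrE] : z \in nbrs E r by rewrite e !inE eqxx orbT.
    by split=> //; rewrite setUC.
  have [pa pz apE zpE] := adj p pD; have [qa qz aqE zqE] := adj q qD.
  apply/card_gt1P; exists [set [set a; p]; [set z; q]], [set [set a; q]; [set z; p]].
  have aNz : a != z by rewrite eq_sym.
  split; try apply: (matching2 (x := a)); rewrite ?set21 //.
  - by rewrite disjoint_set2 aNz eq_sym qa pz.
  - by rewrite disjoint_set2 aNz eq_sym pa qz eq_sym.
  apply/eqP=> /setP/(_ [set a; p]); rewrite set21 !inE => /esym/orP[]/eqP.
    by move/set2_inj/eqP; rewrite (negbTE pq).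
  move=> e; have : a \in [set z; p] by rewrite -e set21.
  by rewrite !inE (negbTE aNz) eq_sym (negbTE pa).
have [/exists_inP[e eE ae]|] := boolP [exists e in E, [disjoint [set a; x] & e]]; last exact: far.
have [/exists_inP[f fE af]|] := boolP [exists e in E, [disjoint [set a; y] & e]]; last exact: far.
apply/card_gt1P; exists [set [set a; x]; e], [set [set a; y]; f].
split; try apply: (matching2 (x := a)); rewrite ?set21 //.
apply/eqP=> /setP/(_ [set a; x]); rewrite set21 !inE => /esym/orP[]/eqP.
  by move/set2_inj/eqP; rewrite (negbTE xy).
by move=> e'; have /pred0P/(_ a) := af; rewrite /= -e' !set21.
Qed.

(** The ratios [(n - k) ^ 2 / k.+1] have product [n!] over [k < n]. *)
Lemma dense_matchings_step (V : finType) (E : {set {set V}}) (W : {set V}) n k :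
    {in E, forall e : {set V}, #|e| = 2} -> {in W, forall v, n <= #|nbrs E v|} ->
    6 < n -> 8 * n <= 3 * #|W| + 4 -> k < n ->
  (n - k) ^ 2 * #|matchings E k| <= k.+1 * #|matchings E k.+1|.
Proof.
move=> E2 degW n6 wE kn; have := matchings_augment E2 degW k.
set m := #|matchings E k|; set m' := #|matchings E k.+1|.
have [q Eq] : exists q, #|W| = 2 * n + q by exists (#|W| - 2 * n); lia.
have [j Ej] : exists j, n = k + j.+1 by exists (n - k.+1); lia.
have -> : n - k = j.+1 by lia.
have -> : #|W| - 2 * k = 2 * j.+1 + q by lia.
rewrite Eq in wE.
have H : 2 * j.+1 * (k + (2 * j.+1 + q).-1) <= (2 * j.+1 + q) * (2 * j.+1 + q).-1.
  have -> : (2 * j.+1 + q).-1 = 2 * j + q + 1 by lia.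
  (* Here [6 < n] enters, through [2 * n <= 3 * q + 4]. With [J = j.+1], the right side minus the
     left is at least [2 J^2 - (q + 4) J + q^2 - q], whose discriminant [-7 q^2 + 16 q + 16] is
     negative from [q = 4] on. *)
  have q4 : 4 <= q by lia.
  nia.
set T := 2 * j.+1 + q in H * => step.
have Tp : 0 < k + T.-1 by rewrite /T; lia.
rewrite -(leq_pmul2l (isT : 0 < 2)) -(leq_pmul2l Tp).
apply: (@leq_trans (j.+1 * (T * T.-1) * m)); last by lia.
apply: (@leq_trans (j.+1 * (2 * j.+1 * (k + T.-1)) * m)); first by rewrite expnS expn1; lia.
by rewrite leq_mul2r leq_mul2l H !orbT.
Qed.

(* For [n <= 6] the last steps lose a little, so that the product of the
   inequalities [matchings_augment], rounded up at each step, is needed. *)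
Lemma dense_matchings (V : finType) (E : {set {set V}}) (W : {set V}) n :
    {in E, forall e : {set V}, #|e| = 2} -> {in W, forall v, n <= #|nbrs E v|} ->
    1 < n -> 8 * n <= 3 * #|W| + 4 ->
  n`! <= #|matchings E n|.
Proof.
move=> E2 degW n2 wE.
have [n6|n6] := ltnP 6 n.
  have H k : k <= n -> (n`!) ^ 2 <= k`! * ((n - k)`!) ^ 2 * #|matchings E k|.
    elim: k => [|k IH] kn; first by rewrite matchings0 subn0 fact0 mul1n muln1.
    apply: leq_trans (IH (ltnW kn)) _.
    have := dense_matchings_step E2 degW n6 wE kn.
    have -> : n - k = (n - k.+1).+1 by lia.
    rewrite !factS; set j := (n - k.+1).+1; set a := k`!; set b := (n - k.+1)`!.
    move=> le; rewrite expnMn.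
    apply: (@leq_trans (a * b ^ 2 * (j ^ 2 * #|matchings E k|))); first by lia.
    apply: (@leq_trans (a * b ^ 2 * (k.+1 * #|matchings E k.+1|))); last by lia.
    by rewrite leq_mul2l le orbT.
  have := H n (leqnn n); rewrite subnn fact0 exp1n muln1 expnS expn1.
  by rewrite leq_pmul2l // fact_gt0.
(* [w] is [(8 * n - 4) / 3] rounded up; cutting [W] down to exactly this size makes the bounds
   numerical. *)
have [w Ew] : exists w, w = (8 * n - 2) %/ 3 by eexists.
have [|W' sW cW] := @subset_of_card V W w; first by lia.
have degW' : {in W', forall v, n <= #|nbrs E v|}.
  by move=> v /(subsetP sW); exact: degW.
have step k := matchings_augment E2 degW' k.
have [Hn|[Hn|[Hn|[Hn|Hn]]]] : n = 2 \/ n = 3 \/ n = 4 \/ n = 5 \/ n = 6 by lia.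
- rewrite Hn; apply: (two_matchings (W := W)); first by lia.
  by move=> v; rewrite -Hn; exact: degW.
- have Ew' : w = 7 by lia.
  move: (step 0) (step 1) (step 2).
  rewrite cW Ew' Hn matchings0 !factS fact0 /subn /=; lia.
- have Ew' : w = 10 by lia.
  move: (step 0) (step 1) (step 2) (step 3).
  rewrite cW Ew' Hn matchings0 !factS fact0 /subn /=; lia.
- have Ew' : w = 12 by lia.
  move: (step 0) (step 1) (step 2) (step 3) (step 4).
  rewrite cW Ew' Hn matchings0 !factS fact0 /subn /=; lia.
- have Ew' : w = 15 by lia.
  move: (step 0) (step 1) (step 2) (step 3) (step 4) (step 5).
  rewrite cW Ew' Hn matchings0 !factS fact0 /subn /=; lia.
Qed.

(** * Monochromatic matchings *)

Section Colored.

Variables (V C : finType) (c : {set V} -> C).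

(** The vertex set is a parameter [A], so that induction can delete vertices while [V] and [c] stay
    fixed. *)
Definition color_class (A : {set V}) (i : C) : {set {set V}} :=
  [set e : {set V} | [&& #|e| == 2, e \subset A & c e == i]].

Definition count_mono (A : {set V}) (n : nat) :=
  \sum_i #|matchings (color_class A i) n|.

Lemma color_class2 A i : {in color_class A i, forall e : {set V}, #|e| = 2}.
Proof. by move=> e; rewrite inE => /and3P[/eqP]. Qed.

Lemma color_classS (A B : {set V}) i : A \subset B -> color_class A i \subset color_class B i.
Proof.
move=> sAB; apply/subsetP=> e; rewrite !inE => /and3P[-> eA ->].
by rewrite (subset_trans eA sAB).
Qed.

Lemma count_monoS (A B : {set V}) n : A \subset B -> count_mono A n <= count_mono B n.
Proof.
by move=> sAB; apply: leq_sum => i _; rewrite subset_leq_card // matchingsS // color_classS.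
Qed.

Lemma leq_count_mono A i n : #|matchings (color_class A i) n| <= count_mono A n.
Proof. by rewrite /count_mono (bigD1 i) //= leq_addr. Qed.

Lemma color_nbrs (A : {set V}) i v :
  v \in A -> nbrs (color_class A i) v = [set x in A :\ v | c [set v; x] == i].
Proof.
move=> vA; apply/setP=> x; rewrite !inE subUset !sub1set vA cards2 /= -andbA.
by rewrite [v == x]eq_sym; case: (x != v).
Qed.

Lemma sum_color_degrees (A : {set V}) v :
  v \in A -> \sum_i #|nbrs (color_class A i) v| = #|A|.-1.
Proof.
move=> vA; rewrite (cardsD1 v A) vA -[RHS]/#|A :\ v|.
rewrite -[RHS]sum1_card (partition_big (fun x => c [set v; x]) predT) //=.
apply: eq_bigr => i _; rewrite color_nbrs // -sum1_card.
by apply: eq_bigl => x; rewrite inE.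
Qed.

Lemma nbrs_color_class (A : {set V}) i u v :
  v \in A -> u \in A -> u != v -> c [set v; u] = i -> u \in nbrs (color_class A i) v.
Proof. by move=> vA uA uv cuv; rewrite color_nbrs // !inE uv uA cuv eqxx. Qed.

(** The deleted set [Q x] is common to all colours, so what remains is again a [count_mono], to
    which induction applies. *)
Lemma count_mono_through_core (J : finType) (A K : {set V}) (I : {set J}) (e : J -> C -> {set V})
    (Q : J -> {set V}) k :
    (forall i, {in I &, injective (e^~ i)}) ->
    {in I, forall x, K \subset Q x} ->
    {in I, forall x i, [/\ e x i \in color_class A i, ~~ [disjoint e x i & K] &
                          e x i \subset Q x]} ->
  \sum_(x in I) count_mono (A :\: Q x) k <= count_mono A k.+1.
Proof.
move=> eI KQ eP; rewrite exchange_big /=; apply: leq_sum => i _.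
apply: leq_trans (@matchings_through_core _ _ _ K I (e^~ i) Q k _ _) => //.
  apply: leq_sum => x _; apply/subset_leq_card/matchingsS/subsetP=> f.
  rewrite !inE subsetD => /and3P[-> /andP[-> ->] ->] //.
by move=> x xI; have [? ? ?] := eP x xI i; split=> //; exact: KQ.
Qed.

End Colored.

(** * Induction steps that delete at most four vertices *)

Section CommonCore.

Variables (V : finType) (c : {set V} -> 'I_3).

Local Notation nb A i v := (nbrs (color_class c A i) v).

(** A set [I] of [m.+1] elements indexes the stars, and [f i x] is the leaf of colour [i] in the
    star [x]. A star has at most four vertices, whence [#|A| - 4]. *)
Lemma rainbow_star_step (A : {set V}) v m L :
    v \in A -> (forall i, m.+1 <= #|nb A i v|) ->
    (forall B : {set V}, #|A| - 4 <= #|B| -> L <= count_mono c B m) ->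
  m.+1 * L <= count_mono c A m.+1.
Proof.
move=> vA deg IH.
have [I _ cI] := subset_of_card (deg ord0).
have /fin_all_exists[f fP] (i : 'I_3) := @inj_extending_id _ I (nb A i v)
  (eq_ind_r (fun k => k <= _) (deg i) cI).
pose Q x := v |: [set f i x | i : 'I_3].
have := @count_mono_through_core _ _ c _ A [set v] I (fun x i => [set v; f i x]) Q m.
move=> H; apply: leq_trans (H _ _ _).
- rewrite -cI -sum_nat_const; apply: leq_sum => x _; apply: IH.
  have : #|Q x| <= 4.
    apply: leq_trans (leq_card_setU _ _) _; rewrite cards1 ltnS.
    by apply: leq_trans (leq_imset_card _ _) _; rewrite card_ord.
  by have := cardsID (Q x) A; have := subset_leq_card (subsetIr A (Q x)); lia.
- by move=> i x y xI yI /set2_inj; have [fI _ _] := fP i; exact: fI.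
- by move=> x _; rewrite sub1set !inE eqxx.
- move=> x xI i; have [_ fN _] := fP i; split.
  + by have := fN x xI; rewrite inE => /andP[].
  + by apply/pred0Pn; exists v; rewrite !inE eqxx.
  + rewrite subUset !sub1set !inE eqxx /=; apply/orP; right.
    by apply/imsetP; exists i.
Qed.

(* [f i] fixes the [i]-neighbours of [v], so one of the two edges at [v] already
   ends at [x] and the four vertices [u], [v], [f i x] suffice. *)
Lemma two_star_step (A : {set V}) u v g m L :
    u \in A -> v \in A -> u != v ->
    (forall i, i != g -> m.+1 <= #|nb A i v|) ->
    m.+1 <= #|(nb A g u :\: nb A g v) :\ v| ->
    (forall B : {set V}, #|A| - 4 <= #|B| -> L <= count_mono c B m) ->
  m.+1 * L <= count_mono c A m.+1.
Proof.
move=> uA vA uv degv degu IH.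
have [I sI cI] := subset_of_card degu.
have IP x : x \in I -> [/\ x \in A, x != v, x \in nb A g u & x \notin nb A g v].
  move/(subsetP sI); rewrite in_setD1 in_setD => /and3P[xv xgv xgu]; split=> //.
  by move: xgu; rewrite color_nbrs // !inE => /andP[/andP[_ ->]].
have ex (i : 'I_3) : exists f : V -> V, i != g ->
    [/\ {in I &, injective f}, {in I, forall x, f x \in nb A i v} &
        {in nb A i v, forall x, f x = x}].
  have [->|ig] := eqVneq i g; first by exists id.
  by have [|f fP] := @inj_extending_id _ I (nb A i v); [rewrite cI degv | exists f].
have {ex} [f fP] := fin_all_exists ex.
pose Q x := [set u; v] :|: [set f i x | i in predC1 g].
pose e x i := if i == g then [set u; x] else [set v; f i x].
have H := @count_mono_through_core _ _ c _ A [set u; v] I e Q m.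
apply: leq_trans (H _ _ _).
- rewrite -cI -sum_nat_const; apply: leq_sum => x _; apply: IH.
  have : #|Q x| <= 4.
    apply: leq_trans (leq_card_setU _ _) _; rewrite cards2 uv !addSn add0n !ltnS.
    by apply: leq_trans (leq_imset_card _ _) _; rewrite cardC1 card_ord.
  by have := cardsID (Q x) A; have := subset_leq_card (subsetIr A (Q x)); lia.
- move=> i x y xI yI; rewrite /e; case: eqP => [_|/eqP ig] /set2_inj //.
  by have [fI _ _] := fP i ig; exact: fI.
- by move=> x _; exact: subsetUl.
- move=> x xI i; have [xA xv xgu xgv] := IP x xI; rewrite /e.
  have [->|ig] := eqVneq i g.
    split; first by move: xgu; rewrite inE => /andP[].
    + by apply/pred0Pn; exists u; rewrite !inE eqxx.
    + rewrite subUset !sub1set in_setU set21 in_setU /=; apply/orP; right.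
      (* The colour [j] of [v x] differs from [g], so [f j] fixes [x], and [Q x] already contains
         the end [x] of the edge [u x]. *)
      pose j := c [set v; x].
      have xj : x \in nb A j v by exact: nbrs_color_class.
      have jg : j != g by apply: contraNneq xgv => <-.
      apply/imsetP; exists j => //.
      by have [_ _ ->] := fP j jg.
  have [_ fN _] := fP i ig; split.
  + by have := fN x xI; rewrite inE => /andP[].
  + by apply/pred0Pn; exists v; rewrite !inE eqxx ?orbT.
  + rewrite subUset !sub1set in_setU set22 in_setU /=; apply/orP; right.
    by apply/imsetP; exists i.
Qed.

Lemma card_setIdE (A : {set V}) (P : pred V) :
  #|[set x in A | P x]| = \sum_(x in A) P x.
Proof.
rewrite -sum1_card; under eq_bigl do rewrite inE.
by rewrite -big_mkcondr; apply: eq_bigr => x _; case: (P x).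
Qed.

End CommonCore.

(** If every vertex has just one small degree, the three sets total [2 * (4 * n - 2)] and the
    largest reaches the average. Otherwise some colour has [b] positive, hence [a = 0], and its set
    misses only vertices counted by the other two [b]. These are not both positive, or all vertices
    would number at most [3 * (n - 1)]; so at most [n - 1] are missing. *)
Lemma dense_color (V : finType) (A : {set V}) n (x y z : V -> nat) :
    1 < n -> #|A| = 4 * n - 2 ->
    {in A, forall v, x v + y v + z v = 4 * n - 3} ->
    {in A, forall v, [|| x v < n, y v < n | z v < n]} ->
    [/\ #|[set v in A | 2 * n - 1 <= x v]| < n, #|[set v in A | 2 * n - 1 <= y v]| < n
      & #|[set v in A | 2 * n - 1 <= z v]| < n] ->
    {in A &, forall u v,
      [/\ x v < n -> n <= y v -> n <= z v -> x u < 2 * n - 1,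
          y v < n -> n <= x v -> n <= z v -> y u < 2 * n - 1 &
          z v < n -> n <= x v -> n <= y v -> z u < 2 * n - 1]} ->
  [\/ 8 * n <= 3 * #|[set v in A | n <= x v]| + 4,
      8 * n <= 3 * #|[set v in A | n <= y v]| + 4
    | 8 * n <= 3 * #|[set v in A | n <= z v]| + 4].
Proof.
move=> n2 cA sd small [bigx bigy bigz] two.
(* [a] counts the vertices whose only small degree is the first one, [b] those
   whose only large degree is the first one. *)
pose a (x y z : V -> nat) := #|[set v in A | [&& x v < n, n <= y v & n <= z v]]|.
pose b (x y z : V -> nat) := #|[set v in A | [&& n <= x v, y v < n & z v < n]]|.
have ab (s t r : V -> nat) : {in A, forall v, s v + t v + r v = 4 * n - 3} ->
    {in A &, forall u v, s v < n -> n <= t v -> n <= r v -> s u < 2 * n - 1} ->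
    #|[set v in A | 2 * n - 1 <= s v]| < n ->
    (0 < a s t r -> b s t r = 0) /\ b s t r < n.
  move=> sum lt big.
  (* Two degrees below [n] leave at least [2 * n - 1] for the third. *)
  have sub : [set v in A | [&& n <= s v, t v < n & r v < n]]
      \subset [set v in A | 2 * n - 1 <= s v].
    by apply/subsetP=> v; rewrite !inE => /and4P[vA *]; rewrite vA; have := sum v vA; lia.
  split; last by apply: leq_ltn_trans big; exact: subset_leq_card.
  move=> /card_gt0P[v]; rewrite inE => /and4P[vA sv tv rv].
  apply/eqP; rewrite cards_eq0 -subset0; apply: subset_trans sub _.
  apply/subsetP=> u; rewrite inE => /andP[uA].
  by have := lt u v uA vA sv tv rv; lia.
have [abx bx] : (0 < a x y z -> b x y z = 0) /\ b x y z < n.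
  by apply: ab => // u v uA vA; case: (two u v uA vA).
have [aby by_] : (0 < a y x z -> b y x z = 0) /\ b y x z < n.
  apply: ab => // [v vA|u v uA vA]; first by have := sd v vA; lia.
  by case: (two u v uA vA).
have [abz bz] : (0 < a z x y -> b z x y = 0) /\ b z x y < n.
  apply: ab => // [v vA|u v uA vA]; first by have := sd v vA; lia.
  by case: (two u v uA vA).
(* The degrees at a vertex cannot all be below [n], since [4 * n - 3 > 3 * (n - 1)]; so one or two
   of them are. *)
have tot : a x y z + a y x z + a z x y + (b x y z + b y x z + b z x y) = 4 * n - 2.
  rewrite -cA -sum1_card /a /b !card_setIdE -!big_split /=.
  by apply: eq_bigr => v vA; have := sd v vA; have := small v vA; lia.
have part (s : V -> nat) k : (\sum_(v in A) (n <= s v) + k = 4 * n - 2) ->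
    #|[set v in A | n <= s v]| = 4 * n - 2 - k.
  by rewrite card_setIdE; lia.
have Wx : #|[set v in A | n <= x v]| = 4 * n - 2 - (a x y z + b y x z + b z x y).
  apply: part; rewrite -cA -sum1_card /a /b !card_setIdE -!big_split /=.
  by apply: eq_bigr => v vA; have := sd v vA; have := small v vA; lia.
have Wy : #|[set v in A | n <= y v]| = 4 * n - 2 - (a y x z + b x y z + b z x y).
  apply: part; rewrite -cA -sum1_card /a /b !card_setIdE -!big_split /=.
  by apply: eq_bigr => v vA; have := sd v vA; have := small v vA; lia.
have Wz : #|[set v in A | n <= z v]| = 4 * n - 2 - (a z x y + b x y z + b y x z).
  apply: part; rewrite -cA -sum1_card /a /b !card_setIdE -!big_split /=.
  by apply: eq_bigr => v vA; have := sd v vA; have := small v vA; lia.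
have : 8 * n <= 3 * #|[set v in A | n <= x v]| + 4 \/
  8 * n <= 3 * #|[set v in A | n <= y v]| + 4 \/
  8 * n <= 3 * #|[set v in A | n <= z v]| + 4.
  move: (a x y z) (a y x z) (a z x y) (b x y z) (b y x z) (b z x y)
    abx aby abz bx by_ bz tot Wx Wy Wz; lia.
by case=> [?|[?|?]]; [exact: Or31|exact: Or32|exact: Or33].
Qed.

Lemma ord3P (P : 'I_3 -> Prop) :
  P ord0 -> P (lift ord0 ord0) -> P ord_max -> forall i, P i.
Proof.
move=> P0 P1 P2 [[|[|[|//]]] Hi].
- by rewrite (_ : Ordinal Hi = ord0) //; exact: val_inj.
- by rewrite (_ : Ordinal Hi = lift ord0 ord0) //; exact: val_inj.
- by rewrite (_ : Ordinal Hi = ord_max) //; exact: val_inj.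
Qed.

Theorem fact_leq_count_mono (V : finType) (c : {set V} -> 'I_3) (A : {set V}) n :
  0 < n -> 4 * n - 2 <= #|A| -> n`! <= count_mono c A n.
Proof.
elim: n A => [//|m IH] A _ leA.
have [B sB cB] := subset_of_card leA.
apply: leq_trans (count_monoS c m.+1 sB) => {A leA sB}.
rename B into A; rename cB into cA.
pose d i v := #|nbrs (color_class c A i) v|.
have IH' : 0 < m -> forall B : {set V}, #|A| - 4 <= #|B| -> m`! <= count_mono c B m.
  by move=> m0 B leB; apply: IH => //; lia.
case: m => [|m] in IH IH' cA *.
  have /card_gt1P[x [y [xA yA xy]]] : 1 < #|A| by rewrite cA.
  apply: leq_trans (leq_count_mono c A (c [set x; y]) 1); rewrite card_gt0.
  apply/set0Pn; exists [set [set x; y]]; apply/matchingsP.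
  rewrite sub1set !inE cards2 xy subUset !sub1set xA yA eqxx cards1.
  by split=> //; exact: trivIset1.
have {}IH := IH' isT.
pose n := m.+2; rewrite -/n in cA *.
have step : m.+2 * m.+1`! = n`! by [].
pose i0 : 'I_3 := ord0; pose i1 : 'I_3 := lift ord0 ord0; pose i2 : 'I_3 := ord_max.
have sumd : {in A, forall v, d i0 v + d i1 v + d i2 v = 4 * n - 3}.
  move=> v vA; have := sum_color_degrees c vA; rewrite 3!big_ord_recl big_ord0 addn0 addnA.
  rewrite (_ : lift ord0 (lift ord0 ord0) = i2); last exact: val_inj.
  by rewrite /d => ->; lia.
have [/exists_inP[v vA /forallP dv]|] := boolP [exists v in A, forall i, n <= d i v].
  by rewrite -step; exact: (rainbow_star_step vA dv IH).
rewrite negb_exists_in => /forall_inP allsmall.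
have small : {in A, forall v, [|| d i0 v < n, d i1 v < n | d i2 v < n]}.
  move=> v vA; move: (allsmall v vA); apply: contraR; rewrite !negb_or -!leqNgt.
  by move=> /and3P[? ? ?]; apply/forallP; exact: (@ord3P (fun i => n <= d i v)).
have big i : #|[set v in A | 2 * n - 1 <= d i v]| < n \/ n`! <= count_mono c A n.
  have [|leS] := ltnP; [by left | right].
  have [S sS cS] := subset_of_card leS.
  apply: leq_trans (leq_count_mono c A i n).
  rewrite -cS; apply: star_matchings => v vS.
  have := subsetP sS v vS; rewrite inE => /andP[_].
  have := cardsID S (nbrs (color_class c A i) v).
  (* As [v] lies in [S] and is not its own neighbour, at most [n - 1] neighbours are in [S], which
     leaves [n] outside. *)
  suff : #|nbrs (color_class c A i) v :&: S| < #|S| by rewrite /d; lia.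
  apply: proper_card; apply/properP; split; first exact: subsetIr.
  by exists v => //; rewrite !inE eqxx.
have two i v u : v \in A -> u \in A -> d i v < n -> (forall j, j != i -> n <= d j v) ->
    d i u < 2 * n - 1 \/ n`! <= count_mono c A n.
  move=> vA uA sv bv; have [|bu] := ltnP; [by left | right].
  have uv : u != v by apply: contraTneq bu => ->; rewrite -ltnNge; lia.
  rewrite -step; apply: (two_star_step (u := u) (v := v) (g := i)) IH => //.
  rewrite -/n.
  have uvN : (v \in nbrs (color_class c A i) u) = (u \in nbrs (color_class c A i) v) := nbrsC _ _ _.
  move: bu sv; rewrite /d; set X := nbrs _ u; set Y := nbrs _ v => bu sv.
  (* If [u v] has colour [i], then [v] is lost from [X :\: Y], but [u] lies in [Y] and not in [X],
     so [X :&: Y] has at most [n - 2] elements. Either way [(2 * n - 1) - (n - 1) = n] vertices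
     remain. *)
  have NY : u \notin X by rewrite inE eqxx.
  have := cardsD1 v (X :\: Y); have := cardsID Y X.
  have := cardsD1 u Y; have : X :&: Y \subset Y :\ u.
    by apply/subsetP=> w; rewrite in_setI => /andP[wX wY]; rewrite in_setD1 wY andbT; apply: contraNneq NY => <-.
  move/subset_leq_card; have := in_setD X Y v.
  rewrite uvN (_ : v \in Y = false); last by rewrite inE eqxx.
  by move=> ->; case: (u \in Y) => /=; lia.
have [//|N] : n`! <= count_mono c A n \/ count_mono c A n < n`! by lia.
have {}big i : #|[set v in A | 2 * n - 1 <= d i v]| < n by case: (big i) => //; lia.
have {}two i v u : v \in A -> u \in A -> d i v < n -> (forall j, j != i -> n <= d j v) ->
    d i u < 2 * n - 1.
  by move=> vA uA sv bv; case: (two i v u vA uA sv bv) => //; lia.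
suff [i Wi] : exists i, 8 * n <= 3 * #|[set v in A | n <= d i v]| + 4.
  apply: leq_trans (leq_count_mono c A i n).
  apply: (@dense_matchings _ _ [set v in A | n <= d i v]) => //.
    exact: color_class2.
  by move=> v; rewrite inE => /andP[].
have [||?|?|?] := @dense_color V A n (d i0) (d i1) (d i2) isT cA sumd small.
- by split.
- by move=> u v uA vA; split=> *; apply: (two _ v u) => //; apply: ord3P.
- by exists i0.
- by exists i1.
- by exists i2.
Qed.

(** * Copies of a matching graph *)

Definition pairs (V : finType) (A : {set V}) : {set {set V}} :=
  [set e : {set V} | (#|e| == 2) && (e \subset A)].

Lemma pairs2 (V : finType) (A : {set V}) : {in pairs A, forall e : {set V}, #|e| = 2}.
Proof. by move=> e; rewrite inE => /andP[/eqP]. Qed.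

Lemma matching_card_vertices (V : finType) (A : {set V}) P k :
  P \in matchings (pairs A) k -> 2 * k <= #|A|.
Proof.
move=> PM; rewrite -(card_cover_matching (@pairs2 _ A) PM).
apply/subset_leq_card/bigcupsP=> e eP.
by have /matchingsP[/subsetP/(_ e eP) + _ _] := PM; rewrite inE => /andP[].
Qed.

(** Disjoint edges select distinct points of [B]. *)
Lemma matching_card_transversal (V : finType) (E P : {set {set V}}) (B : {set V}) k :
  {in E, forall e : {set V}, ~~ [disjoint e & B]} -> P \in matchings E k -> k <= #|B|.
Proof.
move=> meets /matchingsP[/subsetP sP tP <-].
have [->|[e0 e0P]] := set_0Vmem P; first by rewrite cards0.
have /pred0Pn[x0 _] := meets e0 (sP e0 e0P).
pose f (e : {set V}) := odflt x0 [pick x | (x \in e) && (x \in B)].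
have fP e : e \in P -> (f e \in e) && (f e \in B).
  move=> eP; rewrite /f; case: pickP => //= no.
  by have /pred0Pn[x] := meets e (sP e eP); rewrite /= no.
apply: (@leq_card_inj _ _ _ _ f) => [e e' eP e'P eq|e eP].
  apply: (trivIset_eq tP eP e'P (x := f e)); first by case/andP: (fP e eP).
  by rewrite eq; case/andP: (fP e' e'P).
by case/andP: (fP e eP).
Qed.

(** A fixed vertex has [2 * m + 1] possible partners; deleting the pair leaves the case [m]. The
    bound is kept in product form to avoid division. *)
Lemma card_perfect_matchings (V : finType) (A : {set V}) m :
  #|A| <= 2 * m -> #|matchings (pairs A) m| * (2 ^ m * m`!) <= (2 * m)`!.
Proof.
elim: m A => [|m IH] A leA; first by rewrite matchings0.
have [->|[P0 P0M]] := set_0Vmem (matchings (pairs A) m.+1); first by rewrite cards0.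
have cA : #|A| = 2 * m.+1.
  by apply/eqP; rewrite eqn_leq leA (matching_card_vertices P0M).
have [a aA] : exists a, a \in A by apply/set0Pn; rewrite -card_gt0 cA.
pose F x := matchings (pairs (A :\: [set a; x])) m.
have sub : matchings (pairs A) m.+1 \subset
    [set [set a; p.1] |: p.2 | p in dep_pairs (A :\ a) F].
  apply/subsetP=> P PM; have /matchingsP[/subsetP sP tP cP] := PM.
  have covA : cover P = A.
    apply/eqP; rewrite eqEcard cA (card_cover_matching (@pairs2 _ A) PM) leqnn andbT.
    by apply/bigcupsP=> e /sP; rewrite inE => /andP[].
  have [x] : exists x, (a, x) \in darts P.
    by apply: (cover_mate (@pairs2 _ A) PM); rewrite covA.
  rewrite inE /= => axP.
  have /sP := axP; rewrite inE subUset !sub1set cards2 => /and3P[ax _ xA].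
  apply/imsetP; exists (x, P :\ [set a; x]); last by rewrite /= setD1K.
  rewrite in_dep_pairs !inE xA andbT; apply/andP; split.
    by rewrite eq_sym; case: (a =P x) ax.
  apply/and3P; split.
  - apply/subsetP=> e; rewrite !inE => /andP[eax eP].
    have := sP e eP; rewrite inE => /andP[-> eA]; rewrite subsetD eA /=.
    exact: (trivIsetP tP).
  - exact: trivIsetD.
  - by move: (cardsD1 [set a; x] P); rewrite axP cP add1n => -[<-].
have le : #|matchings (pairs A) m.+1| <= \sum_(x in A :\ a) #|F x|.
  apply: leq_trans (subset_leq_card sub) _.
  by apply: leq_trans (leq_imset_card _ _) _; rewrite card_dep_pairs.
have cAa : #|A :\ a| = (2 * m).+1 by have := cardsD1 a A; rewrite aA cA; lia.
have leF : (\sum_(x in A :\ a) #|F x|) * (2 ^ m * m`!) <= (2 * m).+1 * (2 * m)`!.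
  rewrite big_distrl /= -cAa -sum_nat_const; apply: leq_sum => x.
  rewrite in_setD1 => /andP[xa xA]; apply: IH.
  have := cardsID [set a; x] A; rewrite (setIidPr _) ?cA ?cards2.
    by rewrite eq_sym xa; lia.
  by rewrite subUset !sub1set aA xA.
rewrite (_ : (2 * m.+1)`! = (2 * m).+2 * ((2 * m).+1 * (2 * m)`!)); last by rewrite mulnS !factS.
apply: leq_trans (leq_mul (leqnn _) leF); rewrite expnS factS.
apply: leq_trans (leq_mul le (leqnn _)) _; lia.
Qed.

Section Copies.

Variables (n N : nat).

Definition copy_of (P : {set {set 'I_N}}) : {set 'I_N} * graph 'I_N :=
  (cover P, [set e : edge 'I_N | val e \in P]).

Lemma val_copy_of (P : {set {set 'I_N}}) : {in P, forall e : {set 'I_N}, #|e| = 2} -> val @: (copy_of P).2 = P.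
Proof.
move=> P2; apply/setP=> e; apply/imsetP/idP => [[e']|eP].
  by rewrite inE => e'P ->.
have e2 : #|e| == 2 by rewrite P2.
by exists (Sub e e2); rewrite ?inE SubK.
Qed.

(** No vertex of [matching_graph n] is isolated, so the edges of a copy determine its vertices.
    Conversely, numbering the edges of a matching and ordering the ends of each gives an
    embedding. *)
Lemma matching_graph_copyP (S : {set 'I_N} * graph 'I_N) :
  reflect (exists2 P, P \in matchings (pairs setT) n & S = copy_of P)
          (is_copy (matching_graph n) S).
Proof.
have end2 (i : 'I_n) : #|[set (i, false); (i, true)]| == 2 by rewrite cards2 xpair_eqE andbF.
apply: (iffP existsP) => [[f /and3P[/injectiveP fI /eqP S1 /eqP S2]]|[P PM ->]].
  pose m i := [set f (i, false); f (i, true)].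
  have mI i x : (x \in m i) -> exists b, x = f (i, b).
    by rewrite !inE => /orP[]/eqP->; [exists false|exists true].
  have mU i j x : x \in m i -> x \in m j -> i = j.
    by move=> /mI[b ->] /mI[b' /fI[]].
  have mem i b : f (i, b) \in m i by case: b; rewrite !inE eqxx ?orbT.
  have im i : f @: [set (i, false); (i, true)] = m i by rewrite imsetU1 imset_set1.
  exists [set m i | i : 'I_n].
    apply/matchingsP; split.
    - apply/subsetP=> _ /imsetP[i _ ->]; rewrite inE subsetT andbT cards2.
      by rewrite (inj_eq fI) xpair_eqE andbF.
    - apply/trivIsetP=> _ _ /imsetP[i _ ->] /imsetP[j _ ->] ij.
      apply/pred0P=> x /=; apply/negP=> /andP[xi xj].
      by rewrite (mU i j x xi xj) eqxx in ij.
    - rewrite card_imset ?card_ord // => i j ij.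
      by apply: (mU i j (f (i, false))); rewrite -?ij mem.
  rewrite [S]surjective_pairing S1 S2; congr (_, _); apply/setP=> x.
    apply/imsetP/bigcupP => [[[i b] _ ->]|[_ /imsetP[i _ ->] /mI[b ->]]].
      by exists (m i); rewrite ?mem ?imset_f.
    by exists (i, b).
  rewrite !inE; apply/exists_inP/imsetP => [[e0]|[i _ ei]].
    by rewrite inE => /existsP[i /eqP->] /eqP->; exists i; rewrite // im.
  exists (Sub [set (i, false); (i, true)] (end2 i)); last by rewrite SubK im ei.
  by rewrite inE; apply/existsP; exists i; rewrite SubK.
have /matchingsP[/subsetP sP tP cP] := PM.
pose m (i : 'I_n) := enum_val (cast_ord (esym cP) i).
have mP i : m i \in P by exact: enum_valP.
have mI : injective m by move=> i j /enum_val_inj/cast_ord_inj.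
have mS e : e \in P -> exists i, e = m i.
  by move=> eP; exists (cast_ord cP (enum_rank_in eP e)); rewrite /m cast_ordK enum_rankK_in.
have /fin_all_exists[xy xyP] i : exists xy : 'I_N * 'I_N,
    xy.1 != xy.2 /\ m i = [set xy.1; xy.2].
  have := sP _ (mP i); rewrite inE => /andP[/cards2P[x [y [xNy mE]]] _].
  by exists (x, y).
pose f := [ffun p : 'I_n * bool => if p.2 then (xy p.1).2 else (xy p.1).1].
have fm i b : f (i, b) \in m i.
  by rewrite ffunE; have [_ ->] := xyP i; case: b; rewrite !inE eqxx ?orbT.
have im i : f @: [set (i, false); (i, true)] = m i.
  by rewrite imsetU1 imset_set1 !ffunE; have [_ ->] := xyP i.
exists f; apply/and3P; split.
- apply/injectiveP=> -[i b] [j b'] eq.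
  have ij : i = j.
    by apply: mI; apply: (trivIset_eq tP (mP i) (mP j) (fm i b)); rewrite eq.
  rewrite -{}ij in eq *; congr (_, _).
  move: eq; rewrite !ffunE /=; have [xNy _] := xyP i.
  by case: b b' => -[] // eq; rewrite eq eqxx in xNy.
- apply/eqP/setP=> x; apply/bigcupP/imsetP => [[e /mS[i ->]]|[[i b] _ ->]].
    rewrite -im => /imsetP[[j b] _ ->]; by exists (j, b).
  by exists (m i).
- apply/eqP/setP=> e; rewrite !inE; apply/idP/exists_inP => [/mS[i ei]|[e0]].
    exists (Sub [set (i, false); (i, true)] (end2 i)); last by rewrite SubK im ei.
    by rewrite inE; apply/existsP; exists i; rewrite SubK.
  by rewrite inE => /existsP[i /eqP->] /eqP->; rewrite im.
Qed.

Variable c : coloring 3 N.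

(** The default [ord0] falls only on sets that are not edges, which [color_class] discards. *)
Definition set_color (e : {set 'I_N}) : 'I_3 :=
  if insub e is Some e' then c e' else ord0.

Lemma set_color_val (e : edge 'I_N) : set_color (val e) = c e.
Proof. by rewrite /set_color valK. Qed.

(** Any edge of a nonempty matching reveals its colour, so each copy is counted once; the empty
    matching would count once per colour. *)
Lemma card_mono_copies :
  0 < n -> #|mono_copies (matching_graph n) c| = count_mono set_color setT n.
Proof.
move=> n0; rewrite /count_mono.
rewrite (eq_bigl (fun i => i \in [set: 'I_3])); last by move=> i; rewrite inE.
rewrite -card_dep_pairs.
set D := dep_pairs _ _.
have P2 i P : P \in matchings (color_class set_color setT i) n ->
    {in P, forall e : {set 'I_N}, #|e| = 2 /\ set_color e = i}.
  by move=> /matchingsP[/subsetP sP _ _] e /sP; rewrite inE => /and3P[/eqP-> _ /eqP->].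
have Pn (P : {set {set 'I_N}}) : #|P| = n -> exists e, e \in P.
  by move=> cP; apply/set0Pn; rewrite -card_gt0 cP.
have inj : {in D &, injective (fun p : 'I_3 * {set {set 'I_N}} => copy_of p.2)}.
  move=> [i P] [j P']; rewrite !in_dep_pairs => /andP[_ PM] /andP[_ PM'] /= eq.
  have PP : P = P'.
    rewrite -[P]val_copy_of ?eq ?val_copy_of // => e eP.
    - by have [] := P2 _ _ PM' e eP.
    - by have [] := P2 _ _ PM e eP.
  have /matchingsP[_ _ /Pn[e eP]] := PM.
  have [_ <-] := P2 _ _ PM e eP; rewrite PP in eP *.
  by have [_ ->] := P2 _ _ PM' e eP.
rewrite -(card_in_imset inj); apply: eq_card => S; rewrite inE.
apply/andP/imsetP => [[/matching_graph_copyP[P PM ->] /forall_inP mono]|[[i P]]].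
  have /matchingsP[sP tP cP] := PM.
  have [e0 e0P] := Pn P cP.
  exists (set_color e0, P) => //; rewrite in_dep_pairs inE.
  apply/matchingsP; split=> //; apply/subsetP=> e eP.
  have := subsetP sP e eP; rewrite !inE => /andP[e2 ->]; rewrite e2 /=.
  have := subsetP sP e0 e0P; rewrite !inE => /andP[e02 _].
  have inS f f2 : f \in P -> (Sub f f2 : edge 'I_N) \in (copy_of P).2 by rewrite inE SubK.
  have /forall_inP/(_ _ (inS _ e02 e0P)) := mono _ (inS _ e2 eP).
  by rewrite -!set_color_val !SubK.
rewrite in_dep_pairs => /andP[_ PM] ->; split.
  apply/matching_graph_copyP; exists P => //.
  apply: subsetP PM; apply: matchingsS; apply/subsetP=> e.
  by rewrite !inE => /and3P[-> ->].
apply/forall_inP=> e; rewrite inE => eP; apply/forall_inP=> e'; rewrite inE => e'P.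
rewrite -!set_color_val; have [_ ->] := P2 _ _ PM _ eP.
by have [_ ->] := P2 _ _ PM _ e'P.
Qed.

End Copies.

(** * Extremal and exact colourings *)

Definition initial (N a : nat) : {set 'I_N} := [set x : 'I_N | x < a].

Definition banded (N a b : nat) : coloring 3 N :=
  [ffun e : edge 'I_N => if val e \subset initial N a then ord0
                         else if val e \subset initial N b then lift ord0 ord0
                         else ord_max].

Lemma card_interval N a b : #|[set x : 'I_N | a <= x < b]| <= b - a.
Proof.
rewrite cardE -(size_map val) -(size_iota a (b - a)); apply: uniq_leq_size.
  by rewrite (map_inj_uniq val_inj) enum_uniq.
move=> _ /mapP[x + ->]; rewrite mem_enum inE mem_iota => /andP[ax xb].
by rewrite ax subnKC // (leq_trans ax (ltnW xb)).
Qed.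

Lemma card_initial N a : #|initial N a| <= a.
Proof.
have := card_interval N 0 a; rewrite subn0; congr (_ <= _).
Qed.

(** The edges from vertex 0 to the vertices 1, [a] and [b] realise the three colours. *)
Lemma banded_exact N a b : 1 < a -> a < b -> b < N -> exact (banded N a b).
Proof.
move=> a1 ab bN.
have N0 : 0 < N by lia.
have edge0 (x : 'I_N) : 0 < x -> #|[set Ordinal N0; x]| == 2.
  by move=> x0; rewrite cards2 (_ : Ordinal N0 != x) //; apply: contraTneq x0 => <-.
have sub (x : 'I_N) k : 0 < k -> ([set Ordinal N0; x] \subset initial N k) = (x < k).
  by move=> k0; rewrite subUset !sub1set !inE k0.
have hit (x : 'I_N) : 0 < x -> exists e, banded N a b e ==
    if x < a then ord0 else if x < b then lift ord0 ord0 else ord_max.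
  move=> x0; exists (Sub [set Ordinal N0; x] (edge0 x x0)).
  by rewrite ffunE SubK !sub //; lia.
have [lt1 ltaN] : 1 < N /\ a < N by lia.
apply/forallP; apply: ord3P; apply/existsP.
- by have := hit (Ordinal lt1) isT; rewrite /= a1.
- by have := hit (Ordinal ltaN) (ltnW a1); rewrite /= ltnn ab.
- by have := hit (Ordinal bN) (ltn_trans (ltnW a1) ab); rewrite /= ltnn ltnNge (ltnW ab).
Qed.

(** All edges of either later colour meet an interval of fewer than [n] vertices, so these colours
    contain no matching of size [n]. *)
Lemma count_mono_banded N a b n :
    b - a < n -> N - b < n ->
  #|mono_copies (matching_graph n) (banded N a b)| <= #|matchings (pairs (initial N a)) n|.
Proof.
move=> ban Nbn; rewrite card_mono_copies ?(leq_ltn_trans _ ban) //.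
set c := set_color _.
have cE (e : {set 'I_N}) : #|e| == 2 -> c e =
    if e \subset initial N a then ord0 else if e \subset initial N b then lift ord0 ord0
    else ord_max.
  by move=> e2; rewrite -[e in c e](SubK (edge 'I_N) e2) /c set_color_val ffunE SubK.
have cap (e : {set 'I_N}) lo hi : e \subset initial N hi -> ~~ (e \subset initial N lo) ->
    ~~ [disjoint e & [set x : 'I_N | lo <= x < hi]].
  move=> /subsetP sub /subsetPn[x xe]; rewrite inE -leqNgt => xlo.
  by apply/pred0Pn; exists x; rewrite /= xe inE xlo; have := sub x xe; rewrite inE.
have none i lo hi : hi - lo < n ->
    {in color_class c setT i, forall e : {set 'I_N},
       e \subset initial N hi /\ ~~ (e \subset initial N lo)} ->
    #|matchings (color_class c setT i) n| = 0.
  move=> hilo H; apply/eqP; rewrite cards_eq0; apply/eqP/setP=> P; rewrite [RHS]inE.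
  apply/negP=> PM; have := card_interval N lo hi.
  have := matching_card_transversal _ PM => /(_ [set x : 'I_N | lo <= x < hi]).
  move=> /(_ _) K; suff : n <= #|[set x : 'I_N | lo <= x < hi]| by lia.
  by apply: K => e /H[]; exact: cap.
rewrite /count_mono 3!big_ord_recl big_ord0.
rewrite (none (lift ord0 ord0) a b) //; last first.
  move=> e; rewrite inE => /and3P[e2 _]; rewrite cE //.
  by case: ifP => // _; case: ifP.
rewrite (none (lift ord0 (lift ord0 ord0)) b N) //; last first.
  move=> e; rewrite inE => /and3P[e2 _]; rewrite cE //.
  have sN : e \subset initial N N by apply/subsetP=> x _; rewrite inE.
  by case: ifP => // _; case: ifP => // /negbT.
rewrite !addn0; apply/subset_leq_card/matchingsS/subsetP=> e.
rewrite !inE => /and3P[e2 _]; rewrite cE // e2 /=.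
by case: ifP => // _; case: ifP.
Qed.

Lemma matching_copy_size n N (S : {set 'I_N} * graph 'I_N) :
  is_copy (matching_graph n) S -> #|S.2| = n.
Proof.
move=> /matching_graph_copyP[P PM ->].
have /matchingsP[/subsetP sP _ cP] := PM.
rewrite -(card_imset _ val_inj) val_copy_of // => e /sP.
exact: pairs2.
Qed.

Lemma card_edges N : #|{: edge 'I_N}| = 'C(N, 2).
Proof.
rewrite card_sig -[in RHS](card_ord N) -card_draws.
by apply: eq_card => e; rewrite !inE.
Qed.

Lemma exact_recoloring n N (c : coloring 3 N) :
    1 < n -> 3 < 'C(N, 2) ->
  exists2 c' : coloring 3 N, exact c' &
    #|mono_copies (matching_graph n) c'| <= #|mono_copies (matching_graph n) c|.
Proof.
move=> n1 big.
pose better (d : coloring 3 N) :=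
  #|mono_copies (matching_graph n) d| <= #|mono_copies (matching_graph n) c|.
pose used (d : coloring 3 N) := [set d e | e : edge 'I_N].
have better_c : better c by exact: leqnn.
case: (arg_maxnP (fun d => #|used d|) better_c) => d dc dmax.
exists d => //; apply: contraT; rewrite negb_forall => /existsP[a /existsPn un].
have /injectivePn[e [f ef def]] : ~~ injectiveb d.
  apply: contraL big => /injectiveP/leq_card.
  by rewrite card_edges card_ord -leqNgt.
pose d' : coloring 3 N := [ffun x => if x == e then a else d x].
have sub : mono_copies (matching_graph n) d' \subset mono_copies (matching_graph n) d.
  apply/subsetP=> S; rewrite !inE => /andP[cS /forall_inP mono]; rewrite cS /=.
  have eS : e \notin S.2.
    apply/negP=> eS; have /set0Pn[g] : S.2 :\ e != set0.
      have := cardsD1 e S.2; rewrite eS (matching_copy_size cS) add1n => nE.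
      by rewrite -card_gt0 -ltnS -nE.
    rewrite !inE => /andP[ge gS]; have /forall_inP/(_ g gS) := mono e eS.
    by rewrite !ffunE eqxx (negbTE ge) eq_sym (negbTE (un g)).
  apply/forall_inP=> g gS; apply/forall_inP=> h hS.
  have /forall_inP/(_ h hS) := mono g gS; rewrite !ffunE.
  have -> : g == e = false by apply: contraNF eS => /eqP<-.
  by have -> : h == e = false by apply: contraNF eS => /eqP<-.
have le : #|used d'| <= #|used d| := dmax d' (leq_trans (subset_leq_card sub) dc).
suff : used d \proper used d' by move/proper_card; rewrite ltnNge le.
apply/properP; split.
  apply/subsetP=> _ /imsetP[x _ ->].
  have [->|xe] := eqVneq x e.
    by apply/imsetP; exists f; rewrite // ffunE eq_sym (negbTE ef).
  by apply/imsetP; exists x; rewrite // ffunE (negbTE xe).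
exists a; first by apply/imsetP; exists e; rewrite // ffunE eqxx.
by apply/negP=> /imsetP[x _ ax]; have := un x; rewrite -ax eqxx.
Qed.

Lemma no_rainbow_P5 N (c : coloring 3 N) : rainbow_copies (path_graph 5) c = set0.
Proof.
apply/eqP; rewrite -subset0; apply/subsetP=> S; rewrite inE.
move=> /andP[/existsP[f /and3P[/injectiveP fI _ /eqP S2]] /forall_inP rb].
pose u (i : 'I_4) : 'I_5 := widen_ord (leqnSn 4) i.
pose v (i : 'I_4) : 'I_5 := lift ord0 i.
have uv i : #|[set u i; v i]| == 2.
  by rewrite cards2 (_ : u i != v i) // -val_eqE /= /bump /=; lia.
have im i : f @: [set u i; v i] = [set f (u i); f (v i)] by rewrite imsetU1 imset_set1.
have fuv i : #|[set f (u i); f (v i)]| == 2 by rewrite -im card_imset.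
pose g i : edge 'I_N := Sub [set f (u i); f (v i)] (fuv i).
have gS i : g i \in S.2.
  rewrite S2 inE; apply/exists_inP; exists (Sub [set u i; v i] (uv i)).
    by rewrite inE; apply/existsP; exists (u i); apply/existsP; exists (v i); rewrite !SubK !eqxx.
  by rewrite !SubK im.
have gI : injective g.
  move=> i j /(congr1 val); rewrite !SubK -!im => /(imset_inj fI) e.
  have : u i \in [set u j; v j] by rewrite -e set21.
  have : u j \in [set u i; v i] by rewrite e set21.
  by rewrite !inE -!val_eqE /= /bump /= => ? ?; apply: val_inj => /=; lia.
suff /leq_card : injective (c \o g) by rewrite !card_ord.
move=> i j /= cij; apply: gI; apply/eqP.
have /forall_inP/(_ (g j) (gS j)) := rb (g i) (gS i).
by rewrite cij eqxx.
Qed.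

(** * The two Ramsey-type numbers and the final bounds *)

Lemma mono_copies_bound n N (c : coloring 3 N) :
  0 < n -> 4 * n - 2 <= N -> n`! <= #|mono_copies (matching_graph n) c|.
Proof.
move=> n0 leN; rewrite card_mono_copies //.
by apply: fact_leq_count_mono => //; rewrite cardsT card_ord.
Qed.

Lemma mono_copies_exist n N (c : coloring 3 N) :
  0 < n -> 4 * n - 2 <= N -> exists S, S \in mono_copies (matching_graph n) c.
Proof.
move=> n0 leN; apply/set0Pn; rewrite -card_gt0.
by apply: leq_trans (mono_copies_bound c n0 leN); rewrite fact_gt0.
Qed.

(** The first class has [2 * n - 1] vertices, too few for [n] disjoint edges; each other class has
    at most [n - 1]. *)
Lemma no_mono_copies n N : 0 < n -> N <= 4 * n - 3 ->
  mono_copies (matching_graph n) (banded N (2 * n - 1) (3 * n - 2)) = set0.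
Proof.
move=> n0 leN; apply/eqP; rewrite -cards_eq0 -leqn0.
apply: leq_trans (count_mono_banded _ _) _; try lia.
rewrite leqn0 cards_eq0; apply/eqP/setP=> P; rewrite [RHS]inE; apply/negP.
by move=> /matching_card_vertices; have := card_initial N (2 * n - 1); lia.
Qed.

Lemma ramsey_matching n : 1 < n -> is_ramsey 3 (matching_graph n) (4 * n - 2).
Proof.
move=> n1; split=> [c|m' H]; first by apply: mono_copies_exist => //; lia.
rewrite leqNgt; apply/negP=> lt.
have [S] := H (banded m' (2 * n - 1) (3 * n - 2)).
by rewrite no_mono_copies ?inE //; lia.
Qed.

Lemma gallai_ramsey_matching n :
  1 < n -> is_gallai_ramsey 3 (path_graph 5) (matching_graph n) (4 * n - 2).
Proof.
move=> n1; split=> [|m' [_ H]].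
  split=> [|N leN c _]; last by right; apply: mono_copies_exist => //; lia.
  by apply: (@leq_trans 'C(6, 2)) => //; apply: leq_bin2l; lia.
rewrite leqNgt; apply/negP=> lt.
(* The condition covers all sizes from [m'] on, so it is tested at [4 * n - 3], where the banded
   colouring is exact; at [m'] itself a colour might be missing. *)
have le : m' <= 4 * n - 3 by lia.
have [|[S]|[S]] := H _ le (banded _ (2 * n - 1) (3 * n - 2)).
- by apply: banded_exact; lia.
- by rewrite no_rainbow_P5 inE.
- by rewrite no_mono_copies ?inE //; lia.
Qed.

(* The quotient is exact: it counts the perfect matchings of K_{2n}. *)
Theorem theorem3p6 (n : nat) (hn : 2 <= n) :
  exists v : nat,
    [/\ is_GM 3 (path_graph 5) (matching_graph n) v,
        is_M 3 (matching_graph n) v,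
        n`! <= v &
        v <= (2 * n)`! %/ (2 ^ n * n`!)].
Proof.
set N := 4 * n - 2.
pose c0 := banded N (2 * n) (3 * n - 1).
pose count (c : coloring 3 N) := #|mono_copies (matching_graph n) c|.
have [c _ cmin] := @arg_minnP _ c0 predT count isT.
(* A colouring with fewest copies is replaced by an exact one with no more, so both minima agree. *)
have [c' exc' lec'] : exists2 c' : coloring 3 N, exact c' & count c' <= count c.
  apply: exact_recoloring => //.
  by apply: (@leq_trans 'C(6, 2)) => //; apply: leq_bin2l; rewrite /N; lia.
have cc' : count c = count c' by apply/eqP; rewrite eqn_leq lec' cmin.
exists (count c); split.
- exists N; first exact: gallai_ramsey_matching.
  split=> [|_ [d _ ->]].
    by exists c'; rewrite // no_rainbow_P5 cards0 add0n -/(count c').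
  by rewrite no_rainbow_P5 cards0 add0n; exact: cmin.
- exists N; first exact: ramsey_matching.
  by split=> [|_ [d ->]]; [exists c | exact: cmin].
- by apply: mono_copies_bound => //; lia.
(* The monochromatic copies in [c0] are perfect matchings of its first [2 * n] vertices. *)
- apply: leq_trans (cmin c0 isT) _.
  rewrite leq_divRL ?muln_gt0 ?expn_gt0 ?fact_gt0 //.
  apply: leq_trans (card_perfect_matchings (card_initial N (2 * n))).
  by rewrite leq_mul2r count_mono_banded ?orbT // /N; lia.
Qed.
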